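(* Let $\Sigma=\bigcup_{j=1}^{g+1}[a_j,b_j]\subset\mathbb{R}$ be a union of pairwise disjoint compact intervals and $w$ a weight on $\Sigma$ of the form \[ w(x)=\sum_{j=1}^{g+1}\mathbb{1}_{[a_j,b_j]}(x)\,h_j(x)\left(\sqrt{x-a_j}\right)^{\alpha_j}\left(\sqrt{b_j-x}\right)^{\beta_j},\qquad \alpha_j,\beta_j\in\{-1,1\}, \] with $h_j$ positive on $[a_j,b_j]$ and analytic in a neighborhood of it, $\int_\Sigma w=1$; let $p_0,p_1,\dots$ be its orthonormal polynomials. Let $\mathbf{A}\in\mathbb{C}^{n\times n}$ be generic, $\mathbf{A}=\mathbf{V}\boldsymbol{\Lambda}\mathbf{V}^{-1}$ with $\boldsymbol{\Lambda}=\operatorname{diag}(\lambda_1,\ldots,\lambda_n)$, and $\mathbf{b}\in\mathbb{C}^n$. Let $\Gamma$ be a counterclockwise contour enclosing the spectrum of $\mathbf{A}$, $f$ analytic in a region containing $\Gamma$ and its interior, so that $f(\mathbf{A})\mathbf{b}=\frac{1}{2\pi i}\int_\Gamma f(z)(z\mathbf{I}-\mathbf{A})^{-1}\mathbf{b}\,dz$. Let $z_1,\ldots,z_m\in\Gamma\setminus\Sigma$ be quadrature nodes with weights $\omega_1,\ldots,\omega_m$, and define \[ f_{k,m}(\mathbf{A})\mathbf{b}=-\sum_{\ell=0}^{k-1}\left(\sum_{j=1}^m f(z_j)\,\omega_j\,\mathcal{C}_\Sigma[p_\ell w](z_j)\right)p_\ell(\mathbf{A})\mathbf{b},\qquad \rho_m(x)=\int_\Gamma\frac{f(z)}{z-x}\,dz-\sum_{j=1}^m\frac{f(z_j)}{z_j-x}\,\omega_j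 . \] Assume the eigenvalues satisfy $\operatorname{Re}\mathfrak{g}(\lambda_\ell)<\min_{1\le j\le m}\operatorname{Re}\mathfrak{g}(z_j)$ for all $\ell$, that $|f(z)|\le M$ for $z\in\Gamma$, and that $\sum_{j=1}^m|\omega_j|\le 2\pi L$. Then \[ \|f(\mathbf{A})\mathbf{b}-f_{k,m}(\mathbf{A})\mathbf{b}\|_2\le\frac{1}{2\pi}\|\mathbf{V}\|_2\|\mathbf{V}^{-1}\|_2\|\mathbf{b}\|_2\max_{1\le\ell\le n}|\rho_m(\lambda_\ell)|+LM\max_{1\le j\le m}E_k(z_j), \] where $E_k(z)=\left\|\sum_{j=0}^{k-1}\mathcal{S}_\Sigma[p_jw](z)\,p_j(\mathbf{A})\mathbf{b}-(\mathbf{A}-z\mathbf{I})^{-1}\mathbf{b}\right\|_2$.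
   Context: For $z\notin\Sigma$: $\mathcal{C}_\Sigma[p_\ell w](z)=\frac{1}{2\pi i}\int_\Sigma\frac{p_\ell(s)w(s)}{s-z}ds$ and $\mathcal{S}_\Sigma[p_\ell w](z)=2\pi i\,\mathcal{C}_\Sigma[p_\ell w](z)$. $\|\cdot\|_2$ is the Euclidean norm and induced matrix norm. A matrix is generic if it is diagonalizable and has no eigenvalue at an endpoint $a_j,b_j$. $\mathfrak{g}$ is the exterior Green's function of $\Sigma$ with pole at infinity: $\operatorname{Re}\mathfrak{g}$ is harmonic on $\mathbb{C}\setminus\Sigma$, continuous, zero on $\Sigma$, and $\operatorname{Re}\mathfrak{g}(z)=\log|z|+O(1)$ as $z\to\infty$. *)

(* Defs.v *)
From mathcomp Require Import all_boot all_order all_algebra.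
From mathcomp Require Import all_classical all_reals all_analysis.
From mathcomp Require Export complex.
Import Order.TTheory GRing.Theory Num.Theory ComplexField.
Import numFieldNormedType.Exports.

Set Implicit Arguments.
Unset Strict Implicit.
Unset Printing Implicit Defensive.

Local Open Scope ring_scope.
Local Open Scope classical_set_scope.
Local Open Scope complex_scope.

Section Defs.
Variable R : realType.

Definition cabs (z : R[i]) : R := ComplexField.Normc.normc z.

Definition two_pi_i : R[i] := ((2 * pi)%:C * 'i)%C.

Definition cintegral (D : set R) (F : R -> R[i]) : R[i] :=
  (Rintegral lebesgue_measure D (fun t => complex.Re (F t)))
  +i* (Rintegral lebesgue_measure D (fun t => complex.Im (F t))).

Definition C1fun (g : R -> R) : Prop :=
  (forall t, derivable g t 1) /\ continuous (derive1 g).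

Definition piecewise_C1 (g : R -> R) : Prop :=
  exists s : seq R, [/\ path <%R 0 s, last 0 s = 1 &
    forall i, (i < size s)%N -> exists h, C1fun h /\
      forall t, nth 0 (0 :: s) i <= t <= nth 0 s i -> h t = g t].

Definition gam (gx gy : R -> R) (t : R) : R[i] := (gx t +i* gy t)%C.
Definition dgam (gx gy : R -> R) (t : R) : R[i] := (derive1 gx t +i* derive1 gy t)%C.

Definition jordan_contour (gx gy : R -> R) : Prop :=
  [/\ piecewise_C1 gx, piecewise_C1 gy, gam gx gy 0 = gam gx gy 1 &
      forall s t, 0 <= s < 1 -> 0 <= t < 1 -> gam gx gy s = gam gx gy t -> s = t].

Definition trace (gx gy : R -> R) : set R[i] := [set gam gx gy t | t in `[0, 1]].

Definition contour_int (gx gy : R -> R) (F : R[i] -> R[i]) : R[i] :=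
  cintegral `[0, 1] (fun t => F (gam gx gy t) * dgam gx gy t).

Definition winding (gx gy : R -> R) (c : R[i]) : R[i] :=
  contour_int gx gy (fun z => (z - c)^-1) / two_pi_i.

Definition interior_c (gx gy : R -> R) : set R[i] :=
  [set c | ~ trace gx gy c /\ winding gx gy c != 0].

Definition ccw_contour (gx gy : R -> R) : Prop :=
  jordan_contour gx gy /\ forall c, interior_c gx gy c -> winding gx gy c = 1.

Definition holomorphic_on (U : set R[i]) (f : R[i] -> R[i]) : Prop :=
  forall z, U z -> derivable (f : R[i]^o -> R[i]^o) z 1.

Definition vnorm n (v : 'cV[R[i]]_n) : R := Num.sqrt (\sum_(i < n) cabs (v i 0) ^+ 2).

Definition mnorm n m (M : 'M[R[i]]_(n, m)) : R :=
  sup [set vnorm (M *m x) | x in [set x : 'cV[R[i]]_m | vnorm x <= 1]].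

Definition poly_mx n (A : 'M[R[i]]_n.+1) (p : {poly R}) : 'M[R[i]]_n.+1 :=
  horner_mx A (map_poly (fun x : R => (x%:C)%C) p).

Definition matfun_b (gx gy : R -> R) (f : R[i] -> R[i]) n (A : 'M[R[i]]_n)
  (b : 'cV[R[i]]_n) : 'cV[R[i]]_n :=
  \col_(i < n) (contour_int gx gy (fun z => f z * (invmx (z%:M - A) *m b) i 0) / two_pi_i).

Definition Sigma g (a b : 'I_g.+1 -> R) : set R := [set x | exists j, a j <= x <= b j].

Definition jacobi_weight g (a b : 'I_g.+1 -> R) (h : 'I_g.+1 -> R -> R)
  (al be : 'I_g.+1 -> int) (x : R) : R :=
  \sum_(j < g.+1) (if a j <= x <= b j then
     h j x * (Num.sqrt (x - a j)) ^ (al j) * (Num.sqrt (b j - x)) ^ (be j) else 0).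

Definition analytic_near (lo hi : R) (h : R -> R) : Prop :=
  exists O : set R, [/\ open O, `[lo, hi] `<=` O &
    forall x0, O x0 -> exists r : R, 0 < r /\ exists c : nat -> R,
      forall x, `|x - x0| < r ->
        (fun N => \sum_(k < N) c k * (x - x0) ^+ k) @ \oo --> h x].

Definition orthonormal_polys (S : set R) (w : R -> R) (p : nat -> {poly R}) : Prop :=
  (forall l, size (p l) = l.+1 /\ 0 < lead_coef (p l)) /\
  (forall i j, (\int[lebesgue_measure]_(x in S) ((p i).[x] * (p j).[x] * w x)%:E)%E
               = (if i == j then 1 else 0)%:E).

Definition stieltjes (S : set R) (w : R -> R) (p : {poly R}) (z : R[i]) : R[i] :=
  cintegral S (fun s => (p.[s] * w s)%:C / (s%:C - z)).
Definition cauchy_tr (S : set R) (w : R -> R) (p : {poly R}) (z : R[i]) : R[i] :=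
  stieltjes S w p z / two_pi_i.

Definition dx (u : R[i] -> R) (z : R[i]) : R :=
  derive1 (fun s => u (s +i* complex.Im z)%C) (complex.Re z).
Definition dy (u : R[i] -> R) (z : R[i]) : R :=
  derive1 (fun s => u (complex.Re z +i* s)%C) (complex.Im z).

Definition harmonic_on (O : set R[i]) (u : R[i] -> R) : Prop :=
  open (O : set R[i]^o) /\
  forall z, O z ->
    [/\ derivable (fun s => u (s +i* complex.Im z)%C) (complex.Re z) 1,
        derivable (fun s => u (complex.Re z +i* s)%C) (complex.Im z) 1,
        derivable (fun s => dx u (s +i* complex.Im z)%C) (complex.Re z) 1,
        derivable (fun s => dy u (complex.Re z +i* s)%C) (complex.Im z) 1 &
        dx (dx u) z + dy (dy u) z = 0].

Definition green_re (S : set R) (u : R[i] -> R) : Prop :=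
  [/\ continuous (u : R[i]^o -> R^o),
      (forall x, S x -> u x%:C = 0),
      harmonic_on [set z | ~ exists x, S x /\ z = x%:C] u &
      exists K r0 : R, forall z, r0 < cabs z -> `|u z - ln (cabs z)| <= K].

End Defs.

(* Main.v *)
Require Import Defs.
From mathcomp Require Import all_boot all_order all_algebra.
From mathcomp Require Import all_classical all_reals all_analysis.
From mathcomp Require Import complex measurable_realfun ring.
Import Order.TTheory GRing.Theory Num.Theory ComplexField.
Import numFieldNormedType.Exports.
Local Open Scope ring_scope.
Local Open Scope classical_set_scope.
Local Open Scope complex_scope.

(** Writing [A = V Lambda V^-1], the vector [(zI - A)^-1 b] equals
    [V diag (1 / (z - lam_l)) V^-1 b], so linearity of the contour integral turns
    [f(A) b] into [V diag (I_l / (2 pi i)) V^-1 b] with [I_l] the integral of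
    [f(z) / (z - lam_l)].  Splitting [I_l] into its quadrature sum plus
    [rho_m (lam_l)] gives
    [2 pi i (f(A) b - f_{k,m}(A) b)
       = V diag (rho_m (lam_l)) V^-1 b + sum_j omega_j f(z_j) e_j],
    where [e_j] is the vector of which [E_k(z_j)] is the norm, and the triangle
    inequality concludes.  The only analytic input is that the
    integrands are integrable along a piecewise C1 contour. *)

(** Cauchy-Schwarz by Lagrange's identity: twice the gap between the two sides is the sum over all
    pairs of the squares of [u i * v j - u j * v i]. *)
Lemma sum_mul_sqr_le (R : realDomainType) (I : finType) (u v : I -> R) :
  (\sum_i u i * v i) ^+ 2 <= (\sum_i u i ^+ 2) * (\sum_i v i ^+ 2).
Proof.
have lagrange : \sum_i \sum_j (u i * v j - u j * v i) ^+ 2 =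
    2 * ((\sum_i u i ^+ 2) * (\sum_i v i ^+ 2) - (\sum_i u i * v i) ^+ 2).
  have -> : \sum_i \sum_j (u i * v j - u j * v i) ^+ 2 =
      \sum_i \sum_j ((u i ^+ 2 * v j ^+ 2 + v i ^+ 2 * u j ^+ 2)
        - 2 * ((u i * v i) * (u j * v j))).
    by apply: eq_bigr => i _; apply: eq_bigr => j _; ring.
  under eq_bigr do rewrite sumrB big_split/= -!mulr_sumr.
  rewrite sumrB big_split/= -mulr_sumr -!mulr_suml.
  by ring.
have : 0 <= \sum_i \sum_j (u i * v j - u j * v i) ^+ 2.
  by apply: sumr_ge0 => i _; apply: sumr_ge0 => j _; exact: sqr_ge0.
by rewrite lagrange pmulr_rge0 ?subr_ge0.
Qed.

(** * Euclidean norm and induced matrix norm over [R[i]] *)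

Section norms.
Context {R : realType}.
Implicit Type z : R[i].

Lemma normc_cabs z : `|z| = (cabs z)%:C.
Proof. by []. Qed.

Lemma cabs_ge0 z : 0 <= cabs z.
Proof. by case: z => x y; exact: sqrtr_ge0. Qed.

Lemma cabs0 : cabs (0 : R[i]) = 0.
Proof. exact: Normc.normc0. Qed.

Lemma cabsM z z' : cabs (z * z') = cabs z * cabs z'.
Proof. exact: Normc.normcM. Qed.

Lemma cabsV z : cabs z^-1 = (cabs z)^-1.
Proof. exact: Normc.normcV. Qed.

Lemma cabsD z z' : cabs (z + z') <= cabs z + cabs z'.
Proof. exact: le_normcD. Qed.

Lemma cabs_eq0 z : cabs z = 0 -> z = 0.
Proof. exact: Normc.eq0_normc. Qed.

Lemma cabs_two_pi_i : cabs (two_pi_i R) = 2 * pi.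
Proof.
rewrite cabsM /cabs/= expr0n/= expr1n addr0 add0r sqrtr1 mulr1 sqrtr_sqr.
by rewrite ger0_norm// mulr_ge0// pi_ge0.
Qed.

Section vnorm.
Context {n : nat}.
Implicit Type v : 'cV[R[i]]_n.

Lemma vnorm_ge0 v : 0 <= vnorm v.
Proof. exact: sqrtr_ge0. Qed.

Lemma vnorm_sqr v : vnorm v ^+ 2 = \sum_i cabs (v i 0) ^+ 2.
Proof. by rewrite sqr_sqrtr// sumr_ge0// => i _; exact: sqr_ge0. Qed.

Lemma cabs_le_vnorm v i : cabs (v i 0) <= vnorm v.
Proof.
rewrite -(ler_pXn2r (n := 2))// ?nnegrE ?cabs_ge0 ?vnorm_ge0// vnorm_sqr.
by rewrite (bigD1 i)//= lerDl sumr_ge0// => j _; exact: sqr_ge0.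
Qed.

Lemma vnorm0 : vnorm (0 : 'cV[R[i]]_n) = 0.
Proof.
by apply/eqP; rewrite -sqrf_eq0 vnorm_sqr big1// => i _; rewrite mxE cabs0 expr0n.
Qed.

Lemma vnorm_eq0 v : vnorm v = 0 -> v = 0.
Proof.
move=> v0; apply/matrixP => i j; rewrite ord1 mxE; apply: cabs_eq0.
by apply/le_anti; rewrite cabs_ge0 andbT -v0 cabs_le_vnorm.
Qed.

Lemma vnormZ z v : vnorm (z *: v) = cabs z * vnorm v.
Proof.
apply/eqP; rewrite -(eqrXn2 (n := 2))// ?mulr_ge0 ?vnorm_ge0 ?cabs_ge0//.
rewrite exprMn !vnorm_sqr mulr_sumr; apply/eqP/eq_bigr => i _.
by rewrite mxE cabsM exprMn.
Qed.

(** After squaring, the cross term is controlled by Cauchy-Schwarz applied to the moduli of the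
    entries. *)
Lemma vnormD v v' : vnorm (v + v') <= vnorm v + vnorm v'.
Proof.
have CS : \sum_i cabs (v i 0) * cabs (v' i 0) <= vnorm v * vnorm v'.
  rewrite -(ler_pXn2r (n := 2))// ?nnegrE ?mulr_ge0 ?vnorm_ge0//.
    by rewrite exprMn !vnorm_sqr sum_mul_sqr_le.
  by rewrite sumr_ge0// => i _; rewrite mulr_ge0// cabs_ge0.
rewrite -(ler_pXn2r (n := 2))// ?nnegrE ?addr_ge0 ?vnorm_ge0//.
rewrite sqrrD !vnorm_sqr.
apply: (@le_trans _ _ (\sum_i (cabs (v i 0) + cabs (v' i 0)) ^+ 2)).
  apply: ler_sum => i _; rewrite mxE.
  by rewrite ler_pXn2r ?nnegrE ?addr_ge0 ?cabs_ge0// cabsD.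
under eq_bigr do rewrite sqrrD.
by rewrite !big_split/= lerD2r lerD2l lerD.
Qed.

Lemma vnorm_sum (I : finType) (v : I -> 'cV[R[i]]_n) :
  vnorm (\sum_i v i) <= \sum_i vnorm (v i).
Proof.
elim/big_ind2 : _ => [|x y x' y' h h'|//]; first by rewrite vnorm0.
by rewrite (le_trans (vnormD _ _))// lerD.
Qed.

Lemma vnorm_diag_mx (d : 'rV[R[i]]_n) (K : R) v : 0 <= K ->
  (forall i, cabs (d 0 i) <= K) -> vnorm (diag_mx d *m v) <= K * vnorm v.
Proof.
move=> K0 dK.
rewrite -(ler_pXn2r (n := 2))// ?nnegrE ?mulr_ge0 ?vnorm_ge0//.
rewrite exprMn !vnorm_sqr mulr_sumr; apply: ler_sum => i _.
rewrite mul_diag_mx mxE cabsM exprMn ler_wpM2r ?sqr_ge0//.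
by rewrite ler_pXn2r ?nnegrE ?cabs_ge0.
Qed.

End vnorm.

Section mnorm.
Context {n m : nat}.
Implicit Types (M : 'M[R[i]]_(n, m)) (x : 'cV[R[i]]_m).

(** A crude constant suffices: it only ensures that the set under the [sup] in [mnorm] is bounded
    above, so that the [sup] is an upper bound. *)
Lemma vnorm_mulmx_bounded M : exists C, forall x, vnorm (M *m x) <= C * vnorm x.
Proof.
exists (\sum_j vnorm (col j M)) => x.
have -> : M *m x = \sum_j x j 0 *: col j M.
  apply/matrixP => i k; rewrite ord1 mxE summxE; apply: eq_bigr => j _.
  by rewrite !mxE mulrC.
rewrite (le_trans (vnorm_sum _ _))// mulr_suml ler_sum// => j _.
by rewrite vnormZ mulrC ler_wpM2l ?vnorm_ge0 ?cabs_le_vnorm.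
Qed.

Lemma mnorm_ub M x : vnorm x <= 1 -> vnorm (M *m x) <= mnorm M.
Proof.
move=> x1; have [C MC] := vnorm_mulmx_bounded M.
apply: ub_le_sup; last by exists x.
(* The sign of [C] is unknown; the absolute value allows [vnorm y] to be replaced by 1. *)
exists `|C| => _ [y /= y1 <-]; rewrite (le_trans (MC y))//.
rewrite (@le_trans _ _ (`|C| * vnorm y))//.
  by rewrite ler_wpM2r ?vnorm_ge0 ?ler_norm.
by rewrite ler_piMr.
Qed.

Lemma mnorm_ge0 M : 0 <= mnorm M.
Proof.
by have := mnorm_ub M 0; rewrite mulmx0 !vnorm0; apply; exact: ler01.
Qed.

Lemma vnorm_mulmx_le M x : vnorm (M *m x) <= mnorm M * vnorm x.
Proof.
(* The zero vector cannot be normalized; any other [x] is rescaled to norm 1. *)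
have [x0|x0] := eqVneq (vnorm x) 0.
  by rewrite (vnorm_eq0 _ x0) mulmx0 !vnorm0 mulr0.
have cVx : cabs ((vnorm x)^-1)%:C = (vnorm x)^-1.
  by rewrite /cabs/= expr0n/= addr0 sqrtr_sqr ger0_norm// invr_ge0 vnorm_ge0.
have := mnorm_ub M (((vnorm x)^-1)%:C *: x).
rewrite -scalemxAr !vnormZ cVx mulVf// mulrC ler_pdivrMr ?lt_def ?x0 ?vnorm_ge0//.
by apply.
Qed.

End mnorm.
End norms.

(** * Linearity of complex-valued integrals *)

Section cintegral.
Context {R : realType}.
Local Notation mu := (@lebesgue_measure R).

(** [cintegral] integrates the two components separately, and additivity of [Rintegral] requires
    integrability of each. *)
Definition cintegrable (D : set R) (F : R -> R[i]) :=
  mu.-integrable D (EFin \o (fun t => complex.Re (F t))) /\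
  mu.-integrable D (EFin \o (fun t => complex.Im (F t))).

Variables (D : set R) (mD : measurable (D : set (measurableTypeR R))).

Lemma cintegrableZ c F : cintegrable D F -> cintegrable D (fun t => c * F t).
Proof.
move=> [rF iF]; split.
- apply: (@eq_integrable _ _ _ _ _ mD (fun t => (complex.Re c)%:E * (complex.Re (F t))%:E
    - (complex.Im c)%:E * (complex.Im (F t))%:E)%E) => //.
    by move=> t _; rewrite /=; case: c (F t) => [? ?] [? ?].
  by apply: integrableB => //; exact: integrableZl.
- apply: (@eq_integrable _ _ _ _ _ mD (fun t => (complex.Re c)%:E * (complex.Im (F t))%:E
    + (complex.Im c)%:E * (complex.Re (F t))%:E)%E) => //.
    move=> t _; rewrite /=; case: c (F t) => [? ?] [? ?] /=.
    by rewrite -!EFinM -EFinD.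
  by apply: integrableD => //; exact: integrableZl.
Qed.

Lemma cintegralZ c F : cintegrable D F ->
  cintegral D (fun t => c * F t) = c * cintegral D F.
Proof.
move=> [rF iF].
have Z k f : mu.-integrable D (EFin \o f) ->
    mu.-integrable D (EFin \o (fun t => k * f t)).
  by move=> If; exact: (integrableZl mD k If).
case: c => x y; rewrite /cintegral; congr (_ +i* _).
- rewrite -[RHS]/(_ - _) -!RintegralZl// -RintegralB//; [|exact: Z..].
  by apply: eq_Rintegral => t _; case: (F t).
- rewrite -[RHS]/(_ + _) -!RintegralZl// -RintegralD//; [|exact: Z..].
  by apply: eq_Rintegral => t _; case: (F t).
Qed.

Lemma cintegrable0 : cintegrable D (fun=> 0).
Proof. by split; exact: integrable0. Qed.

Lemma cintegral0 : cintegral D (fun=> 0) = 0.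
Proof. by rewrite /cintegral /Rintegral /= integral0. Qed.

Lemma cintegrableD F G : cintegrable D F -> cintegrable D G ->
  cintegrable D (fun t => F t + G t).
Proof.
move=> [rF iF] [rG iG]; split.
- have := integrableD mD rF rG; apply: eq_integrable => // t _ /=.
  by case: (F t) (G t) => [? ?] [? ?].
- have := integrableD mD iF iG; apply: eq_integrable => // t _ /=.
  by case: (F t) (G t) => [? ?] [? ?].
Qed.

Lemma cintegralD F G : cintegrable D F -> cintegrable D G ->
  cintegral D (fun t => F t + G t) = cintegral D F + cintegral D G.
Proof.
move=> [rF iF] [rG iG]; rewrite /cintegral -[RHS]/(_ +i* _).
rewrite -!RintegralD//; congr (_ +i* _); apply: eq_Rintegral => t _;
  by case: (F t) (G t) => [? ?] [? ?].
Qed.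

Lemma cintegral_lin (I : finType) (c : I -> R[i]) (F : I -> R -> R[i]) :
  (forall i, cintegrable D (F i)) ->
  cintegral D (fun t => \sum_i c i * F i t) = \sum_i c i * cintegral D (F i).
Proof.
(* Integrability of the partial sums is carried through the induction, since additivity at the next
   step needs it. *)
move=> IF; suff [] : cintegrable D (fun t => \sum_i c i * F i t) /\
  cintegral D (fun t => \sum_i c i * F i t) = \sum_i c i * cintegral D (F i) by [].
elim: (index_enum I) => [|i s [Is IHs]].
  rewrite big_nil -[X in _ /\ _ = X]cintegral0.
  have -> : (fun t => \sum_(i <- [::]) c i * F i t) = (fun=> 0).
    by apply/funext => t; rewrite big_nil.
  by split => //; exact: cintegrable0.
rewrite big_cons -IHs -cintegralZ//.
have -> : (fun t => \sum_(i <- i :: s) c i * F i t) =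
    (fun t => c i * F i t + \sum_(i <- s) c i * F i t).
  by apply/funext => t; rewrite big_cons.
have IZ := cintegrableZ (c i) _ (IF i).
by split; [exact: cintegrableD | exact: cintegralD].
Qed.

End cintegral.

(** * Integrability along piecewise C1 functions *)

Section contour.
Context {R : realType}.
Local Notation mu := (@lebesgue_measure R).

(** The overlap of [A] and [B] may have positive measure, so the union is rewritten with the
    disjoint pieces [A] and [B] minus [A]. *)
Lemma integrable_setU (d : measure_display) (T : measurableType d)
    (nu : {measure set T -> \bar R}) (A B : set T) (f : T -> \bar R) :
  measurable A -> measurable B -> nu.-integrable A f -> nu.-integrable B f ->
  nu.-integrable (A `|` B) f.
Proof.
move=> mA mB /[dup] /integrableP[mAf iA] /integrableP[_ _] iB.
have mBA : measurable (B `\` A) by exact: measurableD.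
have /integrableP[mBf iBA] : nu.-integrable (B `\` A) f.
  by apply: (integrableS mB) => //; exact: subDsetl.
have UE : A `|` B = A `|` (B `\` A) by rewrite setDE setUIr setUv setIT.
rewrite UE; apply/integrableP.
have mU : measurable_fun (A `|` (B `\` A)) f.
  by apply: (iffRL (measurable_funU _ mA mBA)).
split => //; rewrite ge0_integral_setU//.
- by rewrite lte_add_pinfty.
- exact: measurableT_comp.
- by rewrite disj_set2E setDIK.
Qed.

(** Induction along the subdivision: interval properties that glue at a common endpoint need
    checking only on single C1 pieces. The degenerate case [Q x x] ends the recursion. *)
Lemma piecewise_C1_ind (g : R -> R) (Q : R -> R -> Prop) :
  (forall x, Q x x) ->
  (forall x y z, x <= y -> y <= z -> Q x y -> Q y z -> Q x z) ->
  (forall x y h, x < y -> C1fun h -> (forall t, x <= t <= y -> h t = g t) ->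
    Q x y) ->
  piecewise_C1 g -> Q 0 1.
Proof.
move=> Q0 Qtrans Qpiece.
(* The starting point 0 is generalized because the tail of a subdivision starts at its first knot;
   the inequality is carried along because gluing asks for ordered endpoints. *)
have IH s x0 : path <%R x0 s ->
    (forall i, (i < size s)%N -> exists h, C1fun h /\
      forall t, nth 0 (x0 :: s) i <= t <= nth 0 s i -> h t = g t) ->
    x0 <= last x0 s /\ Q x0 (last x0 s); last first.
  by move=> [s [s0 s1 /(IH _ _ s0)]]; rewrite s1 => -[].
elim: s x0 => [//|x1 s IH] x0 /= /andP[x01 x1s] pieces.
have [|le1 Q1] := IH _ x1s; first by move=> i; exact: (pieces i.+1).
have [h [Ch hg]] := pieces 0%N isT.
split; first exact: le_trans (ltW x01) le1.
by apply: Qtrans (Qpiece _ _ _ x01 Ch hg) Q1 => //; exact: ltW.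
Qed.

Lemma C1fun_continuous (h : R -> R) : C1fun h -> continuous h.
Proof. by move=> [dh _] x; apply/differentiable_continuous/derivable1_diffP. Qed.

Lemma itvcc_setU (x y z : R) : x <= y -> y <= z ->
  `[x, z]%classic = `[x, y] `|` `[y, z].
Proof.
move=> xy yz; apply/seteqP; split => t /=; rewrite !in_itv/=.
  by move=> /andP[xt tz]; have [ty|/ltW yt] := leP t y; [left|right]; apply/andP.
by move=> [|] /andP[h1 h2]; apply/andP; split => //;
  [exact: le_trans yz|exact: le_trans h1].
Qed.

(** Continuity is pasted over closed pieces. It is relative to [[0, 1]] because [g] is unconstrained
    outside. *)
Lemma piecewise_C1_continuous (g : R -> R) :
  piecewise_C1 g -> {within `[0, 1], continuous g}.
Proof.
apply: (@piecewise_C1_ind g (fun x y => {within `[x, y], continuous g})).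
- by move=> x; rewrite set_itv1; exact: continuous_subspace1.
- move=> x y z xy yz cxy cyz; rewrite (itvcc_setU x y z)//.
  by apply: withinU_continuous => //; exact: itv_closed.
- move=> x y h xy /C1fun_continuous Ch hg.
  apply: (@subspace_eq_continuous _ _ _ h); last exact: continuous_subspaceT.
  by move=> t /[!inE]/= /[!in_itv]/=; exact: hg.
Qed.

(** On each piece [phi * h'] is continuous on a compact interval, hence integrable. The derivatives
    of [g] and [h] are known to agree only in the open piece, as [g] may have corners at the knots;
    these form a null set. *)
Lemma integrable_mul_derive1 (phi g : R -> R) :
  {within `[0, 1], continuous phi} -> piecewise_C1 g ->
  mu.-integrable `[0, 1] (EFin \o (fun t => phi t * derive1 g t)).
Proof.
move=> cphi Cg; move: Cg cphi.
pose F := EFin \o (fun t => phi t * derive1 g t).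
have int1 x : mu.-integrable [set x] F.
  by apply: null_set_integrable => //; [exact: measurable_fun_set1|
    exact: lebesgue_measure_set1].
apply: (@piecewise_C1_ind g (fun x y => {within `[x, y], continuous phi} ->
  mu.-integrable `[x, y] F)).
- by move=> x _; rewrite set_itv1.
- move=> x y z xy yz Fxy Fyz cphi; rewrite (itvcc_setU x y z)//.
  apply: integrable_setU => //; [apply: Fxy|apply: Fyz];
    apply: continuous_subspaceW cphi; rewrite (itvcc_setU x y z)//.
- move=> x y h xy [dh ch] hg cphi.
  (* Both endpoints are split off as null singletons, leaving the open interval. *)
  rewrite -(setU1itv false) ?bnd_simp ?ltW// -(setUitv1 true) ?bnd_simp//.
  apply: integrable_setU => //; first exact: measurableU.
  apply: integrable_setU => //.
  have mcc : measurable (`[x, y]%classic : set (measurableTypeR R)) by [].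
  have mxy : measurable (`]x, y[%classic : set (measurableTypeR R)) by [].
  apply: (@eq_integrable _ _ _ _ _ mxy (EFin \o (fun t => phi t * derive1 h t))).
    move=> t /[!inE]/= txy; congr (_%:E); congr (_ * _); rewrite !derive1E.
    (* Around an interior point [h] and [g] coincide on a neighborhood, so their derivatives there
       are equal. *)
    apply: near_eq_derive; near=> s; apply: hg.
    have : s \in `]x, y[%R by near: s; exact: near_in_itvoo.
    by rewrite in_itv/= => /andP[/ltW -> /ltW ->].
  apply: (integrableS mcc mxy); first exact: subset_itvW.
  apply: continuous_compact_integrable; first exact: segment_compact.
  apply/subspace_continuousP => t txy; apply: cvgM.
    by move/subspace_continuousP: cphi; apply.
  by apply: cvg_within_filter; exact: ch.
Unshelve. all: by end_near.
Qed.

End contour.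

(** * Continuity in [R[i]] and integrability of contour integrands *)

Section complex_contour.
Context {R : realType}.
Implicit Types (gx gy : R -> R) (F : R[i] -> R[i]).

Lemma cvg_Re (T : Type) (G : set_system T) (FG : Filter G) (phi : T -> R[i]^o)
    (l : R[i]^o) : phi @ G --> l ->
  (fun t => complex.Re (phi t)) @ G --> complex.Re l.
Proof.
move=> /cvgrPdist_lt phil; apply/cvgrPdist_lt => e e0.
have := phil e%:C; rewrite ltcR => /(_ e0); apply: filterS => t.
rewrite -ltcR; apply: le_lt_trans; have ReB (z z' : R[i]) :
  complex.Re z - complex.Re z' = complex.Re (z - z') by case: z z' => [? ?] [? ?].
by rewrite ReB normc_ge_Re.
Qed.

Lemma cvg_Im (T : Type) (G : set_system T) (FG : Filter G) (phi : T -> R[i]^o)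
    (l : R[i]^o) : phi @ G --> l ->
  (fun t => complex.Im (phi t)) @ G --> complex.Im l.
Proof.
(* Multiplication by [- 'i] turns imaginary parts into real parts, so [cvg_Re] applies. *)
have ImE (z : R[i]) : complex.Im z = complex.Re (- 'i * z).
  by case: z => x y /=; rewrite oppr0 mul0r add0r mulN1r opprK.
move=> phil; rewrite ImE; under eq_cvg do rewrite ImE.
apply: cvg_Re.
exact: (@cvgM R[i] T G FG (fun=> - 'i) phi _ l (cvg_cst _) phil).
Qed.

Lemma cvg_complex (T : Type) (G : set_system T) (FG : Filter G) (u v : T -> R)
    (a b : R) : u @ G --> a -> v @ G --> b ->
  ((fun t => u t +i* v t) : T -> R[i]^o) @ G --> (a +i* b : R[i]^o).
Proof.
move=> /cvgrPdist_lt ua /cvgrPdist_lt vb; apply/cvgrPdist_lt => -[e e'].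
(* In the order of [R[i]] a positive element is real, so the tolerance has zero imaginary part. *)
rewrite ltcE/= => /andP[/eqP -> e0].
have e20 : 0 < e / 2 by rewrite divr_gt0.
near=> t.
rewrite -[X in `|X|]/((a - u t) +i* (b - v t)).
have -> : (a - u t) +i* (b - v t) = (a - u t)%:C + 'i * (b - v t)%:C :> R[i].
  by rewrite [LHS]complexE.
rewrite (le_lt_trans (ler_normD _ _))// normrM.
have abs_real (x : R) : `|x%:C| = `|x|%:C :> R[i].
  by rewrite normc_cabs /cabs/= expr0n/= addr0 sqrtr_sqr.
have -> : `|'i : R[i]| = 1.
  by rewrite normc_cabs /cabs/= expr0n/= expr1n add0r sqrtr1.
rewrite mul1r !abs_real -[X in X < _]/((`|a - u t| + `|b - v t|) +i* (0 + 0)).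
rewrite addr0 ltcR [ltRHS]splitr ltrD//; near: t; [exact: ua|exact: vb].
Unshelve. all: by end_near.
Qed.

(** The real and imaginary parts of [F(gamma) * gamma'] are combinations of four products of a
    continuous real function with the derivative of [gx] or [gy], each covered by
    [integrable_mul_derive1]. *)
Lemma contour_integrable gx gy F : piecewise_C1 gx -> piecewise_C1 gy ->
  (forall z, trace gx gy z -> {for z, continuous (F : R[i]^o -> R[i]^o)}) ->
  cintegrable `[0, 1] (fun t => F (gam gx gy t) * dgam gx gy t).
Proof.
move=> Cx Cy CF; pose phi : R -> R[i]^o := F \o gam gx gy.
have Cphi : forall t : R, `[0, 1]%classic t -> phi @ within `[0, 1] (nbhs t) --> phi t.
  move=> t t01; apply: cvg_comp; last by apply: (CF (gam gx gy t)); exists t.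
  apply: cvg_complex; [move: t t01|move: t t01];
    by apply/subspace_continuousP/piecewise_C1_continuous.
have Cre : {within `[0, 1], continuous (fun t => complex.Re (phi t))}.
  by apply/subspace_continuousP => t t01; apply: cvg_Re; exact: Cphi.
have Cim : {within `[0, 1], continuous (fun t => complex.Im (phi t))}.
  by apply/subspace_continuousP => t t01; apply: cvg_Im; exact: Cphi.
have mI : measurable (`[0, 1]%classic : set (measurableTypeR R)) by [].
split.
- have := integrableB mI (integrable_mul_derive1 _ _ Cre Cx)
    (integrable_mul_derive1 _ _ Cim Cy).
  apply: eq_integrable => // t _ /=.
  by rewrite /phi /=; case: (F _).
- have := integrableD mI (integrable_mul_derive1 _ _ Cre Cy)
    (integrable_mul_derive1 _ _ Cim Cx).
  apply: eq_integrable => // t _ /=.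
  by rewrite /phi /=; case: (F _).
Qed.

Lemma cauchy_kernel_continuous F (c z : R[i]) : z != c ->
  derivable (F : R[i]^o -> R[i]^o) z 1 ->
  {for z, continuous ((fun y : R[i] => F y / (y - c)) : R[i]^o -> R[i]^o)}.
Proof.
move=> zc /derivable1_diffP/differentiable_continuous cF.
apply: (@cvgM R[i] R[i]^o (nbhs (z : R[i]^o)) _ F (fun y => (y - c)^-1)); first exact: cF.
apply: cvgV; first by rewrite subr_eq0.
by apply: cvgB; [exact: cvg_id|exact: cvg_cst].
Qed.

End complex_contour.

(** * Resolvent of a diagonalized matrix *)

Section resolvent.
Context {F : fieldType} {n : nat}.

Lemma invmx_uniq (A B : 'M[F]_n) : B *m A = 1%:M -> invmx A = B.
Proof.
by move=> BA; have [_ uA] := mulmx1_unit BA; rewrite -[LHS]mul1mx -BA mulmxK.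
Qed.

(** A scalar matrix is unchanged by conjugation with [V], so inverting [c - A] amounts to inverting
    diagonal entries. It serves both along the contour and at the quadrature nodes. *)
Lemma resolvent_diag_mx (A V : 'M[F]_n) (lam : 'rV[F]_n) (c : F) :
  V \in unitmx -> A = V *m diag_mx lam *m invmx V ->
  (forall i, c != lam 0 i) ->
  invmx (c%:M - A) = V *m diag_mx (\row_i (c - lam 0 i)^-1) *m invmx V.
Proof.
move=> uV AE clam; apply: invmx_uniq.
have -> : c%:M - A = V *m diag_mx (\row_i (c - lam 0 i)) *m invmx V.
  have -> : diag_mx (\row_i (c - lam 0 i)) = c%:M - diag_mx lam.
    by apply/matrixP => i j; rewrite !mxE mulrnBl.
  by rewrite mulmxBr mulmxBl mul_mx_scalar -scalemxAl mulmxV// scalemx1 AE.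
have dd : diag_mx (\row_i (c - lam 0 i)^-1) *m diag_mx (\row_i (c - lam 0 i)) = 1%:M.
  apply/matrixP => i j; rewrite mul_diag_mx !mxE.
  by case: eqVneq => _; rewrite ?mulr0n ?mulr0// !mulr1n mulVf// subr_eq0.
by rewrite !mulmxA mulmxKV// -(mulmxA V) dd mulmx1 mulmxV.
Qed.

Lemma invmxN (A : 'M[F]_n) : invmx (- A) = - invmx A.
Proof.
rewrite -scaleN1r -[RHS]scaleN1r.
(* On a singular matrix [invmx] returns its argument, so the sign passes through in that case
   too. *)
have [uA|nA] := boolP (A \in unitmx).
  by rewrite invmxZ ?invrN1// unitmxZ ?unitrN1.
by rewrite !invmx_out// inE unitmxZ ?unitrN1.
Qed.

End resolvent.

(** Each entry of the resolvent vector is a finite combination of the kernels [1 / (y - lam_l)].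
    Their poles lie off the contour, so the integrals exist and may be exchanged with the sum. *)
Lemma matfun_b_diag (R : realType) (n : nat) (A V : 'M[R[i]]_n)
    (lam : 'rV[R[i]]_n) (bv : 'cV[R[i]]_n) (gx gy : R -> R) (f : R[i] -> R[i]) :
  V \in unitmx -> A = V *m diag_mx lam *m invmx V ->
  piecewise_C1 gx -> piecewise_C1 gy ->
  (forall l, ~ trace gx gy (lam 0 l)) ->
  (forall y, trace gx gy y -> derivable (f : R[i]^o -> R[i]^o) y 1) ->
  matfun_b gx gy f A bv =
    V *m (diag_mx (\row_l (contour_int gx gy (fun y => f y / (y - lam 0 l))
                            / two_pi_i R)) *m (invmx V *m bv)).
Proof.
move=> uV AE Cx Cy lamG df; apply/matrixP => i k; rewrite ord1 {k} !mxE.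
have Ilam l : cintegrable `[0, 1]
    (fun t => f (gam gx gy t) / (gam gx gy t - lam 0 l) * dgam gx gy t).
  refine (contour_integrable gx gy (fun y : R[i] => f y / (y - lam 0 l)) Cx Cy _).
  move=> y Gy; refine (cauchy_kernel_continuous f (lam 0 l) y _ (df y Gy)).
  by apply/eqP => yl; apply: (lamG l); rewrite -yl.
have -> : contour_int gx gy (fun y => f y * (invmx (y%:M - A) *m bv) i 0) =
    \sum_l V i l * (invmx V *m bv) l 0 *
      contour_int gx gy (fun y => f y / (y - lam 0 l)).
  rewrite /contour_int -cintegral_lin//.
  (* The expansion is claimed only for parameters in [[0, 1]]: elsewhere [gam] might hit an
     eigenvalue. *)
  have eq01 t : t \in `[0, 1]%classic ->
      f (gam gx gy t) * (invmx ((gam gx gy t)%:M - A) *m bv) i 0 * dgam gx gy t =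
      \sum_l V i l * (invmx V *m bv) l 0 *
        (f (gam gx gy t) / (gam gx gy t - lam 0 l) * dgam gx gy t).
    rewrite inE => t01; rewrite (resolvent_diag_mx _ _ _ _ uV AE) => [|l]; last first.
      by apply/eqP => tl; apply: (lamG l); exists t.
    rewrite -!mulmxA mxE mulr_sumr mulr_suml; apply: eq_bigr => l _.
    by rewrite mul_diag_mx !mxE; ring.
  by congr (_ +i* _); apply: eq_Rintegral => t t01; rewrite eq01.
rewrite mulr_suml; apply: eq_bigr => l _.
by rewrite mul_diag_mx !mxE; ring.
Qed.

Theorem theorem4p2 (R : realType)
  (* Sigma = union of g+1 pairwise disjoint compact intervals [a_j, b_j] *)
  (g : nat) (a b : 'I_g.+1 -> R)
  (hab : forall j, a j < b j)
  (hdisj : forall j j', j != j' -> b j < a j' \/ b j' < a j)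
  (* the weight w *)
  (h : 'I_g.+1 -> R -> R) (al be : 'I_g.+1 -> int)
  (hal : forall j, al j = 1 \/ al j = -1)
  (hbe : forall j, be j = 1 \/ be j = -1)
  (hpos : forall j x, a j <= x <= b j -> 0 < h j x)
  (hana : forall j, analytic_near (a j) (b j) (h j))
  (hnorm : (\int[lebesgue_measure]_(x in Sigma a b)
              (jacobi_weight a b h al be x)%:E)%E = 1%E)
  (* orthonormal polynomials *)
  (p : nat -> {poly R})
  (hp : orthonormal_polys (Sigma a b) (jacobi_weight a b h al be) p)
  (* generic matrix A = V Lambda V^-1 and vector b *)
  (n : nat) (A V : 'M[R[i]]_n.+1) (lam : 'rV[R[i]]_n.+1) (bv : 'cV[R[i]]_n.+1)
  (hV : V \in unitmx)
  (hA : A = V *m diag_mx lam *m invmx V)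
  (hgen : forall l j, lam 0 l != (a j)%:C /\ lam 0 l != (b j)%:C)
  (* counterclockwise contour enclosing the spectrum *)
  (gx gy : R -> R)
  (hG : ccw_contour gx gy)
  (hspec : forall l, interior_c gx gy (lam 0 l))
  (* f analytic in a region containing Gamma and its interior *)
  (f : R[i] -> R[i]) (U : set R[i])
  (hU : open (U : set R[i]^o))
  (hUG : trace gx gy `|` interior_c gx gy `<=` U)
  (hf : holomorphic_on U f)
  (* quadrature nodes and weights *)
  (m : nat) (z omega : 'I_m -> R[i])
  (hz : forall j, trace gx gy (z j))
  (hzS : forall j, ~ (exists x, Sigma a b x /\ z j = x%:C))
  (* Green's function condition *)
  (u : R[i] -> R) (hu : green_re (Sigma a b) u)
  (hgreen : forall l j, u (lam 0 l) < u (z j))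
  (* bounds *)
  (Mf L : R)
  (hM : forall y, trace gx gy y -> cabs (f y) <= Mf)
  (hL : \sum_(j < m) cabs (omega j) <= 2 * pi * L)
  (k : nat) :
  let w := jacobi_weight a b h al be in
  let S := Sigma a b in
  let fkm : 'cV[R[i]]_n.+1 :=
    - \sum_(l < k)
        ((\sum_(j < m) f (z j) * omega j * cauchy_tr S w (p l) (z j))
           *: (poly_mx A (p l) *m bv)) in
  let rho (x : R[i]) : R[i] :=
    contour_int gx gy (fun y => f y / (y - x))
    - \sum_(j < m) f (z j) / (z j - x) * omega j in
  let E (zz : R[i]) : R :=
    vnorm (\sum_(l < k) (stieltjes S w (p l) zz *: (poly_mx A (p l) *m bv))
           - invmx (A - zz%:M) *m bv) in
  vnorm (matfun_b gx gy f A bv - fkm)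
  <= (2 * pi)^-1 * mnorm V * mnorm (invmx V) * vnorm bv
       * \big[Num.max/0]_(l < n.+1) cabs (rho (lam 0 l))
     + L * Mf * \big[Num.max/0]_(j < m) E (z j).
Proof.
pose w := jacobi_weight a b h al be.
pose S := Sigma a b.
pose fkm : 'cV[R[i]]_n.+1 :=
  - \sum_(l < k)
      ((\sum_(j < m) f (z j) * omega j * cauchy_tr S w (p l) (z j))
         *: (poly_mx A (p l) *m bv)).
pose rho (x : R[i]) : R[i] :=
  contour_int gx gy (fun y => f y / (y - x))
  - \sum_(j < m) f (z j) / (z j - x) * omega j.
pose E (zz : R[i]) : R :=
  vnorm (\sum_(l < k) (stieltjes S w (p l) zz *: (poly_mx A (p l) *m bv))
         - invmx (A - zz%:M) *m bv).
change (vnorm (matfun_b gx gy f A bv - fkm)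
  <= (2 * pi)^-1 * mnorm V * mnorm (invmx V) * vnorm bv
       * \big[Num.max/0]_(l < n.+1) cabs (rho (lam 0 l))
     + L * Mf * \big[Num.max/0]_(j < m) E (z j)).
have [[Cx Cy _ _] _] := hG.
pose c := two_pi_i R.
pose a_ j := f (z j) * omega j.
pose P (l : 'I_k) := poly_mx A (p l) *m bv.
pose err j := \sum_(l < k) stieltjes S w (p l) (z j) *: P l
  - invmx (A - (z j)%:M) *m bv.
have lamG l : ~ trace gx gy (lam 0 l) by case: (hspec l).
have zlam j l : z j != lam 0 l.
  by apply/eqP => zl; apply: (lamG l); rewrite -zl; exact: hz.
have df y : trace gx gy y -> derivable (f : R[i]^o -> R[i]^o) y 1.
  by move=> Gy; apply: hf; apply: hUG; left.
pose vrho := V *m (diag_mx (\row_l rho (lam 0 l)) *m (invmx V *m bv)).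
have decomp : matfun_b gx gy f A bv - fkm =
    c^-1 *: (vrho + \sum_j a_ j *: err j).
  rewrite (matfun_b_diag R _ A V lam bv gx gy f hV hA Cx Cy lamG df).
  (* Definition of [rho] read backwards: contour integral equals remainder plus quadrature sum,
     entry by entry. *)
  have -> : (\row_l (contour_int gx gy (fun y => f y / (y - lam 0 l)) / two_pi_i R)) =
      c^-1 *: (\row_l rho (lam 0 l) + \sum_j a_ j *: \row_l (z j - lam 0 l)^-1).
    apply/rowP => l; rewrite !mxE summxE mulrC; congr (_ * _).
    rewrite /rho -addrA [X in _ + X](_ : _ = 0) ?addr0//.
    rewrite -sumrN -big_split big1// => j _.
    by rewrite /= !mxE /a_; ring.
  rewrite linearZ linearD linear_sum /=.
  rewrite -scalemxAl -scalemxAr mulmxDl mulmxDr -/vrho.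
  (* Exchanging the two sums regroups [fkm] by node; the factor [c^-1] comes from the Cauchy
     transform being the Stieltjes transform over [two_pi_i]. *)
  have -> : fkm = - (c^-1 *: \sum_j a_ j *:
      \sum_(l < k) stieltjes S w (p l) (z j) *: P l).
    congr (- _); under eq_bigr do rewrite scaler_suml.
    rewrite exchange_big scaler_sumr; apply: eq_bigr => j _.
    rewrite scalerA scaler_sumr; apply: eq_bigr => l _.
    by rewrite scalerA; congr (_ *: _); rewrite /cauchy_tr /a_ /c; ring.
  rewrite opprK -scalerDr -addrA; congr (_ *: (_ + _)).
  rewrite mulmx_suml mulmx_sumr -big_split; apply: eq_bigr => j _ /=.
  rewrite linearZ /= -scalemxAl -scalemxAr -scalerDr addrC; congr (_ *: (_ + _)).
  (* The node kernels reassemble into the resolvent of [A] at [z j], and its sign flip gives the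
     minus sign in [err]. *)
  rewrite !mulmxA -(resolvent_diag_mx A V lam (z j) hV hA (zlam j)).
  by rewrite -opprB invmxN mulNmx.
have cabs_cV : cabs c^-1 = (2 * pi)^-1 by rewrite cabsV cabs_two_pi_i.
have pi2 : 0 < 2 * pi :> R by rewrite mulr_gt0// pi_gt0.
set Mrho := \big[_/_]_(l < _) _; set ME := \big[_/_]_(j < m) _.
(* Both maxima start from 0, hence are nonnegative even without nodes. *)
have Mrho0 : 0 <= Mrho by exact: bigmax_ge_id.
have ME0 : 0 <= ME by exact: bigmax_ge_id.
(* [Mf] dominates a modulus at the point of parameter 0 on the contour. *)
have Mf0 : 0 <= Mf.
  apply: le_trans (hM (gam gx gy 0) _); first exact: cabs_ge0.
  by exists 0 => //=; rewrite in_itv/= lexx ler01.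
have le_vrho : vnorm vrho <= mnorm V * mnorm (invmx V) * vnorm bv * Mrho.
  rewrite (le_trans (vnorm_mulmx_le _ _))// -!mulrA ler_wpM2l ?mnorm_ge0//.
  rewrite (@le_trans _ _ (Mrho * vnorm (invmx V *m bv)))//.
    apply: vnorm_diag_mx => // l; rewrite mxE.
    exact: (le_bigmax _ (fun l => cabs (rho (lam 0 l)))).
  by rewrite mulrA [leRHS]mulrC ler_wpM2l// vnorm_mulmx_le.
(* The factor [2 * pi] from the bound on the weights cancels the modulus of [c^-1] at the end. *)
have le_err : vnorm (\sum_j a_ j *: err j) <= 2 * pi * (L * Mf * ME).
  rewrite (le_trans (vnorm_sum _ _))//.
  rewrite (@le_trans _ _ (\sum_j cabs (omega j) * (Mf * ME)))//; last first.
    by rewrite -mulr_suml -(mulrA L) (mulrA (2 * pi) L) ler_wpM2r// mulr_ge0.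
  apply: ler_sum => j _; rewrite vnormZ cabsM [cabs _ * _]mulrC -mulrA.
  rewrite ler_wpM2l ?cabs_ge0// ler_pM ?cabs_ge0 ?vnorm_ge0//.
    by apply: hM; exact: hz.
  exact: (le_bigmax _ (fun j => E (z j))).
rewrite decomp vnormZ cabs_cV.
rewrite (@le_trans _ _ ((2 * pi)^-1 * (vnorm vrho + vnorm (\sum_j a_ j *: err j))))//.
  by rewrite ler_wpM2l ?vnormD// invr_ge0 ltW.
rewrite mulrDr lerD//.
  by rewrite -!mulrA ler_wpM2l ?invr_ge0 ?(ltW pi2)// !mulrA.
by rewrite mulrC ler_pdivrMr// [leRHS]mulrC.
Qed.
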